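(* There exist numerical constants $c,c'>0$ such that for all $L,\Delta,\sigma^2>0$ and all $0<\epsilon\le c'\sqrt{L\Delta}$, $$\mathfrak{m}^{\mathsf{zr,active}}_\epsilon(\Delta,L,\sigma^2)\;\ge\; c\cdot\frac{\Delta L\sigma^2}{\epsilon^4},$$ where the complexity $\mathfrak{m}^{\mathsf{zr,active}}_\epsilon$ in the active oracle model is defined with oracles whose seed space $\mathcal{Z}$ is finite and whose seed distribution $P_z$ is uniform on $\mathcal{Z}$. Constructions of dimension $d=O\big(\frac{\Delta L}{\epsilon^2}\big)$ realize the lower bound.
   Context: Function class. For a dimension $d$, $\mathcal{F}(\Delta,L)$ is the set of differentiable $F:\mathbb{R}^d\to\mathbb{R}$ with $F(0)-\inf_xF(x)\le\Delta$ and $\|\nabla F(x)-\nabla F(y)\|\le L\|x-y\|$ for all $x,y$ (Euclidean norms). Oracles. An oracle $\mathsf{O}$ consists of a distribution $P_z$ on a space $\mathcal{Z}$ (here: $\mathcal{Z}$ finite, $P_z$ uniform) and, for each $F\in\mathcal{F}(\Delta,L)$, a map $\mathsf{O}_F(x,z)=(F(x),g(x,z))$ ($g$ may depend on $F$) with $\mathbb{E}_{z\sim P_z}[g(x,z)]=\nabla F(x)$ and $\mathbb{E}_{z\sim P_z}\|g(x,z)-\nabla F(x)\|^2\le\sigma^2$ for all $x$. Active oracle model. At round $i$ the algorithm proposes both a point $x^{(i)}\in\mathbb{R}^d$ and a seed $z^{(i)}\in\mathcal{Z}$, and receives $(F(x^{(i)}),g(x^{(i)},z^{(i)}))=\mathsf{O}_F(x^{(i)},z^{(i)})$.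 The choice $(x^{(i)},z^{(i)})$ is a measurable function of the algorithm's random seed (drawn once at the start) and the first $i-1$ responses; the algorithm may know $P_z$. With $\mathrm{support}(x)=\{i: x_i\neq0\}$, the algorithm is zero-respecting if for every oracle and every $t\ge1$, $\mathrm{support}(x^{(t)})\subseteq\bigcup_{i<t}\mathrm{support}(g^{(i)})$, where $g^{(i)}$ is the gradient estimate returned at round $i$ (so $x^{(1)}=0$). Complexity. $$\mathfrak{m}^{\mathsf{zr,active}}_\epsilon(\Delta,L,\sigma^2)=\sup_{P_{\mathsf{O}}}\ \sup_{P_F}\ \inf_{\mathsf{A}}\ \inf\big\{T\in\mathbb{N}:\ \mathbb{E}\|\nabla F(x^{(T)}_{\mathsf{A}[\mathsf{O}_F]})\|\le\epsilon\big\},$$ where $P_{\mathsf{O}}$ ranges over probability distributions on the set of oracles $\mathsf{O}$ that have a finite seed space $\mathcal{Z}$, the uniform seed distribution $P_z$ on $\mathcal{Z}$, and, for each $F\in\mathcal{F}(\Delta,L)$, a gradient estimator $g$ that is unbiased for $\nabla F$ with variance at most $\sigma^2$ at every $x$; $P_F$ ranges over probability distributions on $\mathcal{F}(\Delta,L)$, $\mathsf{A}$ over zero-respecting algorithms in the active model, $x^{(T)}_{\mathsf{A}[\mathsf{O}_F]}$ is the point proposed at round $T$ by $\mathsf{A}$ interacting with $\mathsf{O}_F$, and the expectation is over $\mathsf{O}\sim P_{\mathsf{O}}$, $F\sim P_F$ and the algorithm's randomness. Dimension. The dimension $d$ is a free parameter of these definitions; ''constructions of dimension $d$ realize the lower bound''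 means that the inequality holds for the complexity defined using functions on $\mathbb{R}^d$ with a $d$ of the stated size. $f=O(g)$ means $f\le Cg$ for a numerical constant $C$ uniformly over all arguments. *)

(* Defs.v *)
From HB Require Import structures.
From mathcomp Require Import all_boot all_order all_algebra.
From mathcomp Require Import all_classical all_reals all_analysis.

Set Implicit Arguments.
Unset Strict Implicit.
Unset Printing Implicit Defensive.

Import Order.TTheory GRing.Theory Num.Theory.
Import numFieldNormedType.Exports.

Local Open Scope classical_set_scope.
Local Open Scope ring_scope.

(* The library norm of 'rV[R]_d is the sup norm. *)
Definition enorm (R : realType) (d : nat) (x : 'rV[R]_d) : R :=
  Num.sqrt (\sum_(i < d) x 0 i ^+ 2).

Definition grad (R : realType) (d : nat) (F : 'rV[R]_d -> R) (x : 'rV[R]_d) :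
    'rV[R]_d :=
  \row_(i < d) 'D_(delta_mx 0 i) F x.

Definition supp (R : realType) (d : nat) (x : 'rV[R]_d) : set 'I_d :=
  [set i | x 0 i != 0].

(* The Borel sigma-algebra of R^d, generated by the coordinate maps. *)
Definition coordinate_sets (R : realType) (d : nat) : set (set 'rV[R]_d) :=
  \bigcup_(i : 'I_d)
    preimage_set_system setT (fun x : 'rV[R]_d => x 0 i) measurable.

Notation borel_rV R d := (g_sigma_algebraType (@coordinate_sets R d)).

Section FunctionClass.
Variables (R : realType) (d : nat) (Delta L : {posnum R}).

(* The infimum is taken in \bar R: it is -oo for functions that are not bounded
   below, which are thereby excluded. *)
Record fclass := FClass {
  fclass_fun :> 'rV[R]_d -> R;
  fclass_diff : forall x, differentiable fclass_fun x;
  fclass_gap : ((fclass_fun 0)%:E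
                 - ereal_inf (range (fun x => (fclass_fun x)%:E))
               <= Delta%:num%:E)%E;
  fclass_smooth : forall x y,
    enorm (grad fclass_fun x - grad fclass_fun y) <= L%:num * enorm (x - y)
}.

Lemma enorm0 : enorm (0 : 'rV[R]_d) = 0.
Proof.
rewrite /enorm big1 ?sqrtr0// => i _.
by rewrite mxE expr0n.
Qed.

Lemma enorm_ge0 (x : 'rV[R]_d) : 0 <= enorm x.
Proof. exact: sqrtr_ge0. Qed.

Lemma fclass0_gap : ((0 : R)%:E - ereal_inf (range (fun _ : 'rV[R]_d => 0%:E))
  <= Delta%:num%:E)%E.
Proof.
have -> : range (fun _ : 'rV[R]_d => (0 : R)%:E) = [set 0%:E].
  by apply/seteqP; split=> [_ [x _ <-]//|_ ->]; exists 0.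
by rewrite ereal_inf1 sube0 lee_fin.
Qed.

Lemma fclass0_smooth (x y : 'rV[R]_d) :
  enorm (grad (fun _ : 'rV[R]_d => (0 : R)) x
         - grad (fun _ : 'rV[R]_d => (0 : R)) y)
    <= L%:num * enorm (x - y).
Proof.
have grad0 z : grad (fun _ : 'rV[R]_d => (0 : R)) z = 0.
  by apply/rowP => i; rewrite !mxE derive_cst.
by rewrite !grad0 subrr enorm0 mulr_ge0// enorm_ge0.
Qed.

Definition fclass0 : fclass :=
  FClass (fun x => differentiable_cst (0 : R) x) fclass0_gap fclass0_smooth.

HB.instance Definition _ := gen_eqMixin fclass.
HB.instance Definition _ := gen_choiceMixin fclass.
HB.instance Definition _ := isPointed.Build fclass fclass0.

Definition evaluation_sets : set (set fclass) :=
  \bigcup_(x : 'rV[R]_d)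
    preimage_set_system setT (fun F : fclass => F x) measurable.

End FunctionClass.

Notation fclass_space d Delta L :=
  (g_sigma_algebraType (@evaluation_sets _ d Delta L)).

Section ActiveModel.
Variables (R : realType) (d : nat) (Delta L sigma2 : {posnum R}).

(* A nonempty finite seed space is identified with 'I_(oracle_seeds.+1). *)
Record oracle := Oracle {
  oracle_seeds : nat;
  oracle_grad : fclass d Delta L -> 'rV[R]_d -> 'I_oracle_seeds.+1 -> 'rV[R]_d;
  oracle_unbiased : forall F x,
    (oracle_seeds.+1%:R)^-1 *: \sum_(z < oracle_seeds.+1) oracle_grad F x z
      = grad F x;
  oracle_variance : forall F x,
    (oracle_seeds.+1%:R)^-1 *
      \sum_(z < oracle_seeds.+1) enorm (oracle_grad F x z - grad F x) ^+ 2
      <= sigma2%:num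
}.

Arguments oracle_grad : clear implicits.

(* A probability distribution on the set of oracles is given as the law of a
   random oracle.  No sigma-algebra on the set of all oracles makes
   (O, F, x) |-> oracle_grad O F x z measurable (the dependence of an oracle on
   F and x being arbitrary), so joint measurability is part of the data.
   The seed space is itself random; for a seed z outside of it, inord z is the
   default seed 0. *)
Record oracle_distribution := OracleDistribution {
  od_display : measure_display;
  od_space : measurableType od_display;
  od_prob : probability od_space R;
  od_oracle : od_space -> oracle;
  od_measurable_seeds :
    measurable_fun setT (fun w => oracle_seeds (od_oracle w));
  od_measurable_grad : forall z : nat,
    measurable_fun setT
      (fun u : od_space * fclass_space d Delta L * borel_rV R d =>
         oracle_grad (od_oracle u.1.1) u.1.2 u.2 (inord z) : borel_rV R d)
}.

Local Notation response := (R * borel_rV R d)%type.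

(* Knowing P_z amounts to knowing the size n.+1 of the seed space.  alg_point n t
   and alg_seed n t choose the query of round t.+1 from the random seed of the
   algorithm and the t responses received so far. *)
Record algorithm := Algorithm {
  alg_display : measure_display;
  alg_space : measurableType alg_display;
  alg_prob : probability alg_space R;
  alg_point : forall n t : nat, alg_space * t.-tuple response -> borel_rV R d;
  alg_seed : forall n t : nat, alg_space * t.-tuple response -> 'I_n.+1;
  alg_measurable_point : forall n t : nat,
    measurable_fun setT (@alg_point n t);
  alg_measurable_seed : forall (n t : nat) (z : 'I_n.+1),
    measurable [set u | @alg_seed n t u = z]
}.

Arguments alg_point : clear implicits.
Arguments alg_seed : clear implicits.

Section Run.
Variables (A : algorithm) (O : oracle) (F : fclass d Delta L).
Variable r : alg_space A.

Definition answer (q : 'rV[R]_d * 'I_(oracle_seeds O).+1) : response :=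
  (F q.1, oracle_grad O F q.1 q.2).

(* history t is the tuple of the responses to rounds 1, ..., t. *)
Fixpoint history (t : nat) : t.-tuple response :=
  match t with
  | 0 => [tuple]
  | s.+1 =>
      let h := history s in
      [tuple of rcons h (answer (alg_point A (oracle_seeds O) s (r, h),
                                 alg_seed A (oracle_seeds O) s (r, h)))]
  end.

(* The point proposed at round t.+1. *)
Definition query_point (t : nat) : 'rV[R]_d :=
  alg_point A (oracle_seeds O) t (r, history t).

End Run.

Definition zero_respecting (A : algorithm) : Prop :=
  forall (O : oracle) (F : fclass d Delta L) (r : alg_space A) (t : nat),
    supp (query_point O F r t) `<=`
    \bigcup_(s : 'I_t) supp (tnth (history O F r t) s).2.

(* E ||grad F(x^(t.+1))||, with the oracle, the function and the random seed of
   the algorithm drawn independently. *)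
Definition expected_grad (PO : oracle_distribution)
    (PF : probability (fclass_space d Delta L) R) (A : algorithm) (t : nat) :
    \bar R :=
  \int[(od_prob PO \x PF) \x alg_prob A]_w
    (enorm (grad (w.1.2 : fclass d Delta L)
       (query_point (od_oracle w.1.1) w.1.2 w.2 t)))%:E.

Definition rounds_needed (eps : R) (PO : oracle_distribution)
    (PF : probability (fclass_space d Delta L) R) (A : algorithm) : \bar R :=
  ereal_inf [set (t.+1%:R)%:E | t in
    [set t | (expected_grad PO PF A t <= eps%:E)%E]].

(* Image-set notation is avoided here: the universes of oracle_distribution and
   algorithm are too large for it. *)
Definition zr_active_complexity (eps : R) : \bar R :=
  ereal_sup [set u | exists PO : oracle_distribution,
    u = ereal_sup [set v | exists PF : probability (fclass_space d Delta L) R,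
      v = ereal_inf [set w | exists2 A : algorithm, zero_respecting A &
        w = rounds_needed eps PO PF A]]].

End ActiveModel.

Arguments oracle_grad {R d Delta L sigma2} o F x z.
Arguments alg_point {R d} a n t u.
Arguments alg_seed {R d} a n t u.

(* Main.v *)
(* The hard function is a chain
     sum_i [ barrier(x_i) - step_1(x_(i-1)) step_3(x_i) ]
   made of piecewise quadratic pieces: a coordinate has zero derivative until
   the preceding one has moved, the gradient has norm at least 1 as long as some
   coordinate vanishes, and the gradient is Lipschitz with a constant independent
   of the dimension.  The seed space has N ~ sigma^2 / eps^2 elements and the random
   oracle hides, for every i, a uniform secret key p_i among the seeds: the first
   coordinate on which x and all its successors vanish is revealed only by the
   seed p_i, with its derivative multiplied by N.  Hence a zero-respecting
   algorithm discovers the coordinates one by one, and each discovery amounts to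
   guessing a key.  Given the algorithm, the set of the rounds at which a guess
   succeeds determines the keys, so at most 'C(t, d) of the N^d key vectors are
   exhausted within t rounds, which is at most half of them when 8 t <= d N.
   Finally d ~ Delta L / eps^2 is the largest length of the chain that the
   rescaled function allows. *)

Require Import Defs.
From HB Require Import structures.
From mathcomp Require Import all_boot all_order all_algebra.
From mathcomp Require Import all_classical all_reals all_analysis.
From mathcomp Require Import measurable_realfun ring lra.

Set Implicit Arguments.
Unset Strict Implicit.
Unset Printing Implicit Defensive.

Import Order.TTheory GRing.Theory Num.Theory.
Import numFieldNormedType.Exports.

Local Open Scope classical_set_scope.
Local Open Scope ring_scope.

(** * The hard function *)

Section ScalarFunctions.
Variable R : realType.
Implicit Types (x y w : R).

Definition relu x : R := Num.max x 0.
Definition hinge x : R := relu x ^+ 2 / 2.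

(* A C^1 ramp, equal to 0 before 1 - w and to w ^+ 2 after 1 + w. *)
Definition step w x : R :=
  hinge (x - 1 + w) - 2 * hinge (x - 1) + hinge (x - 1 - w).
Definition dstep w x : R :=
  relu (x - 1 + w) - 2 * relu (x - 1) + relu (x - 1 - w).

Lemma relu_ge0 x : 0 <= relu x.
Proof. by rewrite /relu le_max lexx orbT. Qed.

Lemma relu_id x : 0 <= x -> relu x = x.
Proof. by rewrite /relu => x0; rewrite max_l. Qed.

Lemma relu_eq0 x : x <= 0 -> relu x = 0.
Proof. by rewrite /relu => x0; rewrite max_r. Qed.

Lemma relu_lipschitz x y : `|relu x - relu y| <= `|x - y|.
Proof.
rewrite /relu; case: (leP x 0) => hx; case: (leP y 0) => hy;
  by rewrite ler_norml; apply/andP; split; case: (ger0P (x - y)) => ?; lra.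
Qed.

Lemma hinge_ge0 x : 0 <= hinge x.
Proof. by rewrite /hinge divr_ge0 ?sqr_ge0. Qed.

(** The remainder is quadratic on both sides of the kink at 0, so a single estimate gives the
    derivative of [hinge] everywhere. *)
Lemma hinge_expansion x h : `|hinge (x + h) - hinge x - h * relu x| <= h ^+ 2.
Proof.
rewrite /hinge /relu ler_norml; case: (leP x 0) => hx; case: (leP (x + h) 0) => hy;
  by apply/andP; split; have := sqr_ge0 (x + h); have := sqr_ge0 x;
     have := sqr_ge0 h; nra.
Qed.

Lemma is_derive_hinge x : is_derive x (1 : R) hinge (relu x).
Proof.
suff H : (fun h : R => h^-1 *: (hinge (h *: (1 : R) + x) - hinge x)) @ 0^' --> relu x.
  apply: DeriveDef; first by apply/cvg_ex; exists (relu x).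
  by apply: cvg_lim.
apply/cvgrPdist_le => e e0.
near=> h.
have h0 : h != 0 by near: h; exact: nbhs_dnbhs_neq.
have he : `|h| <= e by near: h; apply: dnbhs0_le.
have := hinge_expansion x h; rewrite /GRing.scale /= mulr1 [h + x]addrC => H.
have -> : relu x - h^-1 * (hinge (x + h) - hinge x)
    = - (h^-1 * (hinge (x + h) - hinge x - h * relu x)) by field.
rewrite normrN normrM normfV ler_pdivrMl ?normr_gt0//.
apply: (le_trans H); rewrite -real_normK ?num_real// expr2.
by rewrite ler_wpM2l.
Unshelve. all: by end_near.
Qed.

Lemma is_derive_shift (f : R -> R) (x c df : R) :
  is_derive (x + c) (1 : R) f df -> is_derive x (1 : R) (fun t => f (t + c)) df.
Proof.
move=> fd; rewrite -[df]mulr1; apply: (@is_derive1_comp _ f (fun t => t + c) x) => //.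
by apply: is_derive_eq; rewrite addr0.
Qed.

Lemma is_derive_step w x : is_derive x (1 : R) (step w) (dstep w x).
Proof.
have H c : is_derive x (1 : R) (fun t => hinge (t + c)) (relu (x + c)).
  by apply: is_derive_shift; exact: is_derive_hinge.
have -> : step w = (fun t => hinge (t + (w - 1)))
    - (2 : R) \*: (fun t => hinge (t - 1)) + (fun t => hinge (t + (- 1 - w))).
  apply/funext => t; rewrite /step !fctE.
  by congr (hinge _ - _ + hinge _); lra.
apply: is_derive_eq; rewrite /dstep /GRing.scale /=.
by congr (relu _ - _ + relu _); lra.
Qed.

Lemma dstep_ge0 w x : 0 < w -> 0 <= dstep w x.
Proof.
move=> w0; rewrite /dstep /relu.
by case: (leP (x - 1 + w) 0) => ?; case: (leP (x - 1) 0) => ?;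
  case: (leP (x - 1 - w) 0) => ?; lra.
Qed.

Lemma dstep_le w x : 0 < w -> dstep w x <= w.
Proof.
move=> w0; rewrite /dstep /relu.
by case: (leP (x - 1 + w) 0) => ?; case: (leP (x - 1) 0) => ?;
  case: (leP (x - 1 - w) 0) => ?; lra.
Qed.

Lemma step_ge0 w x : 0 < w -> 0 <= step w x.
Proof.
move=> w0; rewrite /step /hinge /relu.
by case: (leP (x - 1 + w) 0) => ?; case: (leP (x - 1) 0) => ?;
  case: (leP (x - 1 - w) 0) => ?; nra.
Qed.

Lemma step_le w x : 0 < w -> step w x <= w ^+ 2.
Proof.
move=> w0; rewrite /step /hinge /relu.
by case: (leP (x - 1 + w) 0) => ?; case: (leP (x - 1) 0) => ?;
  case: (leP (x - 1 - w) 0) => ?; nra.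
Qed.

Lemma step_eq0 w x : 0 < w -> x <= 1 - w -> step w x = 0.
Proof.
move=> w0 hx; rewrite /step /hinge !relu_eq0; [|lra..].
by rewrite expr0n /= !mul0r mulr0 subrr addr0.
Qed.

Lemma step_plateau w x : 0 < w -> 1 + w <= x -> step w x = w ^+ 2.
Proof. by move=> w0 hx; rewrite /step /hinge !relu_id; [field|lra..]. Qed.

Lemma dstep_eq0 w x : 0 < w -> x <= 1 - w -> dstep w x = 0.
Proof.
move=> w0 hx; rewrite /dstep !relu_eq0; [|lra..].
by rewrite mulr0 subrr addr0.
Qed.

(** [dstep w] is the tent of height w on [1 - w, 1 + w]. For w = 3 it is at least 1 from -1, below
    which the barrier takes over, up to 2, where [step 1] saturates. *)
Lemma dstep3_ge1 x : -1 <= x <= 2 -> 1 <= dstep 3 x.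
Proof.
move=> /andP[h1 h2]; rewrite /dstep /relu.
by case: (leP (x - 1 + 3) 0) => ?; case: (leP (x - 1) 0) => ?;
  case: (leP (x - 1 - 3) 0) => ?; lra.
Qed.

Lemma dstep_lipschitz w x y : `|dstep w x - dstep w y| <= 4 * `|x - y|.
Proof.
have := relu_lipschitz (x - 1 + w) (y - 1 + w).
have := relu_lipschitz (x - 1) (y - 1).
have := relu_lipschitz (x - 1 - w) (y - 1 - w).
have -> : x - 1 - w - (y - 1 - w) = x - y by ring.
have -> : x - 1 - (y - 1) = x - y by ring.
have -> : x - 1 + w - (y - 1 + w) = x - y by ring.
rewrite /dstep !ler_norml => /andP[? ?] /andP[? ?] /andP[? ?].
by apply/andP; split; lra.
Qed.

Lemma step_lipschitz w x y : 0 < w -> `|step w x - step w y| <= w * `|x - y|.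
Proof.
move=> w0; wlog xy : x y / y <= x.
  move=> H; case: (leP y x) => [|/ltW] xy; first exact: H.
  by rewrite distrC (distrC x); exact: H.
have [c _ ->] : exists2 c, c \in `[y, x] & step w x - step w y = dstep w c * (x - y).
  apply: MVT_segment => // [z _|]; first exact: is_derive_step.
  apply: derivable_within_continuous => z _.
  by case: (is_derive_step w z).
by rewrite normrM ler_wpM2r// ger0_norm ?dstep_ge0 ?dstep_le.
Qed.

End ScalarFunctions.

Lemma differentiable_derivable1 (R : realType) (g : R -> R) (y dg : R) :
  is_derive y (1 : R) g dg -> differentiable g y.
Proof. by case=> dg1 _; exact/derivable1_diffP. Qed.

Lemma is_derive_chain (R : realType) (V : normedModType R) (g : R -> R)
    (u : V -> R) (x v : V) (dg du : R) :
  differentiable u x -> is_derive x v u du -> is_derive (u x) (1 : R) g dg ->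
  is_derive x v (g \o u) (dg * du).
Proof.
move=> ux [_ uv] gux; have gd := differentiable_derivable1 gux.
have cd := differentiable_comp ux gd.
apply: DeriveDef; first exact: diff_derivable.
rewrite deriveE// diff_comp//=.
have -> : 'd u x v = du *: (1 : R) by rewrite -deriveE// uv /GRing.scale/= mulr1.
rewrite linearZ/= -deriveE//.
by rewrite (@derive_val _ _ _ _ _ _ _ gux) /GRing.scale/= mulrC.
Qed.

(** * The chain, its gradient and the Lipschitz constant of the gradient *)

Section Chain.
Variables (R : realType) (d : nat).
Implicit Types (x y : 'rV[R]_d) (k : nat).

(* x is padded by 2, where [step 1] saturates, on the left and by -2, where
   [step 3] vanishes, on the right, so that the boundary terms of the chain need
   no separate treatment. *)
Definition padded x k : R :=
  if k is i.+1 then (if insub i is Some j then x 0 j else -2) else 2.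

Arguments padded : simpl never.

(** The barrier [hinge (- _)] has slope at most -1 below -1, where the slope of [step 3] drops under
    1. *)
Definition link k x : R :=
  hinge (- padded x k.+1) - step 1 (padded x k) * step 3 (padded x k.+1).

Definition chain x : R := \sum_(i < d) link i x.

Definition dchain x : 'rV[R]_d :=
  \row_(j < d) (- relu (- padded x j.+1)
    - step 1 (padded x j) * dstep 3 (padded x j.+1)
    - dstep 1 (padded x j.+1) * step 3 (padded x j.+2)).

Lemma padded_ord x (i : 'I_d) : padded x i.+1 = x 0 i.
Proof. by rewrite /padded valK. Qed.

Lemma padded_ge x k : (d <= k)%N -> padded x k.+1 = -2.
Proof. by move=> dk; rewrite /padded insubF// ltnNge dk. Qed.

Lemma differentiable_padded k x : differentiable (padded ^~ k) x.
Proof.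
case: k => [|k]; first exact: differentiable_cst.
by rewrite /padded; case: insubP => [j _ _|_];
  [exact: differentiable_coord|exact: differentiable_cst].
Qed.

Lemma derive_coord x (i j : 'I_d) :
  'D_(delta_mx 0 j) (fun y : 'rV[R]_d => y 0 i) x = (i == j)%:R.
Proof.
rewrite /derive.
set q := (X in lim (X @ _)).
have -> : q = fun h : R => h^-1 * (h * (i == j)%:R).
  by apply/funext => h; rewrite /q /= !mxE eqxx /= /GRing.scale /= addrK.
apply: cvg_lim => //; apply: (@cvg_trans _ ((fun=> (i == j)%:R) @ 0^')); last exact: cvg_cst.
apply: near_eq_cvg; near=> h.
have h0 : h != 0 by near: h; exact: nbhs_dnbhs_neq.
by rewrite mulKf.
Unshelve. all: by end_near.
Qed.

Lemma is_derive_padded k x (j : 'I_d) :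
  is_derive x (delta_mx 0 j) (padded ^~ k) (k == j.+1)%:R.
Proof.
apply: DeriveDef; first exact/diff_derivable/differentiable_padded.
case: k => [|k]; first by rewrite derive_cst.
rewrite /padded eqSS; case: insubP => [i _ <-|kd].
  by rewrite derive_coord.
rewrite derive_cst; apply/esym/eqP; rewrite pnatr_eq0 eqb0.
by apply: contra kd => /eqP->.
Qed.

Lemma differentiable_padded_comp (g dg : R -> R) k x :
  (forall t, is_derive t (1 : R) g (dg t)) ->
  differentiable (g \o padded ^~ k) x.
Proof.
move=> gd; apply: differentiable_comp; first exact: differentiable_padded.
exact: differentiable_derivable1.
Qed.

Lemma is_derive_padded_comp (g dg : R -> R) k x (j : 'I_d) :
  (forall t, is_derive t (1 : R) g (dg t)) ->
  is_derive x (delta_mx 0 j) (g \o padded ^~ k)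
    (dg (padded x k) * (k == j.+1)%:R).
Proof.
move=> gd; apply: is_derive_chain => //; first exact: differentiable_padded.
exact: is_derive_padded.
Qed.

Lemma is_derive_hingeN (t : R) :
  is_derive t (1 : R) (fun s : R => hinge (- s)) (- relu (- t)).
Proof.
rewrite -mulrN1; apply: (@is_derive1_comp _ (@hinge R) -%R) => //.
exact: is_derive_hinge.
Qed.

Lemma linkE k : link k = ((fun s => hinge (- s)) \o padded ^~ k.+1)
  - (step 1 \o padded ^~ k) * (step 3 \o padded ^~ k.+1).
Proof. by []. Qed.

Lemma differentiable_link k x : differentiable (link k) x.
Proof.
rewrite linkE; apply: differentiableB.
  exact: differentiable_padded_comp is_derive_hingeN.
by apply: differentiableM; apply: differentiable_padded_comp (is_derive_step _).
Qed.

Lemma chainE : chain = \sum_(i < d) link i.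
Proof. by apply/funext => x; rewrite /chain fct_sumE. Qed.

Lemma differentiable_chain x : differentiable chain x.
Proof. by rewrite chainE; apply: differentiable_sum => i; exact: differentiable_link. Qed.

Lemma sum_delta (F : nat -> R) k :
  (forall i, (d <= i)%N -> F i = 0) -> \sum_(i < d) F i * (i == k :> nat)%:R = F k.
Proof.
move=> F0; have [kd|dk] := ltnP k d.
  rewrite (bigD1 (Ordinal kd))//= eqxx mulr1 big1 ?addr0// => i.
  by rewrite -val_eqE/= => /negPf->; rewrite mulr0.
rewrite F0// big1// => i _; rewrite (_ : _ == _ = false) ?mulr0//.
by apply/negbTE; rewrite neq_ltn (leq_trans (ltn_ord i)).
Qed.

Lemma sum_delta_ord (F : 'I_d -> R) (j : 'I_d) : \sum_i F i * (i == j)%:R = F j.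
Proof.
rewrite (bigD1 j)//= eqxx mulr1 big1 ?addr0// => i /negPf->.
by rewrite mulr0.
Qed.

Lemma grad_chain x : grad chain x = dchain x.
Proof.
apply/rowP => j; rewrite !mxE chainE.
pose e := padded x.
have H (i : 'I_d) : is_derive x (delta_mx 0 j) (link i)
   (- relu (- e i.+1) * (i == j)%:R
    - (step 1 (e i) * (dstep 3 (e i.+1) * (i == j)%:R)
       + step 3 (e i.+1) * (dstep 1 (e i) * (i == j.+1 :> nat)%:R))).
  rewrite linkE; apply: is_deriveB.
    exact: is_derive_padded_comp is_derive_hingeN.
  by apply: is_deriveM; apply: is_derive_padded_comp (is_derive_step _).
rewrite (@derive_val _ _ _ _ _ _ _ (is_derive_sum H)) big_split/=.
rewrite sumrN big_split/=.
have -> : \sum_(i < d) step 3 (e i.+1) * (dstep 1 (e i) * (i == j.+1 :> nat)%:R)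
    = step 3 (e j.+2) * dstep 1 (e j.+1).
  under eq_bigr => i _ do rewrite mulrA.
  (* For the last coordinate, [j.+1] is not an index of the sum; the right padding by -2 makes the
     corresponding term vanish. *)
  rewrite (@sum_delta (fun k => step 3 (e k.+1) * dstep 1 (e k)))// => i di.
  by rewrite /e padded_ge// step_eq0 ?mul0r//; lra.
under [X in _ - (X + _)]eq_bigr => i _ do rewrite mulrA.
by rewrite !sum_delta_ord opprD addrA [step 3 _ * dstep 1 _]mulrC.
Qed.

(* The three summands of every entry of dchain are nonpositive: they cannot
   cancel. *)
Lemma dchain_large x (j : 'I_d) : padded x j.+1 < 2 -> 1 <= enorm (dchain x).
Proof.
(* Take the first coordinate below 2 = 1 + 1: its predecessor, or the left padding, lies where
   [step 1] equals 1. *)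
move=> xj; have [i [xi xi1]] : exists i : 'I_d, 2 <= padded x i /\ padded x i.+1 < 2.
  have ex : exists k, padded x k.+1 < 2 by exists j.
  have := ex_minnP ex; case: ex_minnP => m hm mmin _.
  have mj : (m <= j)%N by exact: mmin.
  exists (Ordinal (leq_ltn_trans mj (ltn_ord j))) => /=; split=> //.
  case: m hm mmin {mj} => [|m] hm mmin; first by rewrite /padded.
  by rewrite leNgt; apply/negP => /mmin; rewrite ltnn.
apply: (@le_trans _ _ `|dchain x 0 i|); last first.
  rewrite -sqrtr_sqr ler_sqrt ?sumr_ge0// => [|k _]; last exact: sqr_ge0.
  by rewrite (bigD1 i)//= lerDl sumr_ge0// => k _; exact: sqr_ge0.
rewrite ler_normr; apply/orP; right; rewrite mxE.
set e0 := padded x i in xi *; set e1 := padded x i.+1 in xi1 *.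
set e2 := padded x _.
have -> : step 1 e0 = 1 :> R by rewrite step_plateau ?expr1n//; lra.
have := relu_ge0 (- e1); have := @dstep_ge0 _ 3 e1 ltac:(lra).
have h : 0 <= dstep 1 e1 * step 3 e2.
  by rewrite mulr_ge0 ?dstep_ge0 ?step_ge0//; lra.
rewrite mul1r => h1 h2.
(* Up to -1 the barrier contributes at least 1; between -1 and 2 the tent [dstep 3] does. *)
have [e1n|e1p] := leP e1 (-1); first by move: h2; rewrite relu_id; lra.
have : 1 <= dstep 3 e1 by apply: dstep3_ge1; rewrite !ltW.
by lra.
Qed.

Definition gap2 x y k : R := (padded x k - padded y k) ^+ 2.

(** An entry depends on three consecutive padded coordinates, with Lipschitz weights 3, 1 + 4 + 36 =
    41 and 3, all at most 41. The factor 3 comes from (u + v + w)^2 <= 3 (u^2 + v^2 + w^2). *)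
Lemma dchain_lipschitz_coord x y (j : 'I_d) :
  (dchain x 0 j - dchain y 0 j) ^+ 2
    <= 41 ^+ 2 * 3 * (gap2 x y j + gap2 x y j.+1 + gap2 x y j.+2).
Proof.
rewrite !mxE /gap2.
set a0 := padded x j; set a1 := padded x j.+1; set a2 := padded x j.+2.
set b0 := padded y j; set b1 := padded y j.+1; set b2 := padded y j.+2.
have r01 : (0 : R) < 1 by lra. have r03 : (0 : R) < 3 by lra.
have h1 := relu_lipschitz (- a1) (- b1).
have h2 := step_lipschitz a0 b0 r01.
have h3 := dstep_lipschitz 3 a1 b1.
have h4 := dstep_lipschitz 1 a1 b1.
have h5 := step_lipschitz a2 b2 r03.
have p1 : `|step 1 a0 * dstep 3 a1 - step 1 b0 * dstep 3 b1|
    <= 3 * `|a0 - b0| + 4 * `|a1 - b1|.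
  have -> : step 1 a0 * dstep 3 a1 - step 1 b0 * dstep 3 b1 =
    (step 1 a0 - step 1 b0) * dstep 3 a1 + step 1 b0 * (dstep 3 a1 - dstep 3 b1).
    by ring.
  apply: (le_trans (ler_normD _ _)); rewrite !normrM; apply: lerD.
    rewrite mulrC ler_pM//; first by rewrite ger0_norm ?dstep_ge0 ?dstep_le.
    by rewrite -[leRHS]mul1r.
  rewrite -[leRHS]mul1r ler_pM//.
  rewrite ger0_norm ?step_ge0//; have := step_le b0 r01.
  by rewrite expr1n.
have p2 : `|dstep 1 a1 * step 3 a2 - dstep 1 b1 * step 3 b2|
    <= 36 * `|a1 - b1| + 3 * `|a2 - b2|.
  have -> : dstep 1 a1 * step 3 a2 - dstep 1 b1 * step 3 b2 =
    step 3 a2 * (dstep 1 a1 - dstep 1 b1) + dstep 1 b1 * (step 3 a2 - step 3 b2).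
    by ring.
  apply: (le_trans (ler_normD _ _)); rewrite !normrM; apply: lerD.
    have -> : 36 * `|a1 - b1| = 9 * (4 * `|a1 - b1|) by ring.
    rewrite ler_pM// ger0_norm ?step_ge0//; have := step_le a2 r03; lra.
  rewrite -[leRHS]mul1r ler_pM//.
  by rewrite ger0_norm ?dstep_ge0 ?dstep_le.
have h1' : `|relu (- a1) - relu (- b1)| <= `|a1 - b1|.
  by rewrite (le_trans h1)// opprK addrC distrC.
set D := (X in X ^+ 2 <= _).
have {h1 h2 h3 h4 h5 h1' p1 p2} H : `|D| <= 41 * (`|a0 - b0| + `|a1 - b1| + `|a2 - b2|).
  have -> : D = - (relu (- a1) - relu (- b1))
     - (step 1 a0 * dstep 3 a1 - step 1 b0 * dstep 3 b1)
     - (dstep 1 a1 * step 3 a2 - dstep 1 b1 * step 3 b2) by rewrite /D; ring.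
  apply: (le_trans (ler_normB _ _)).
  apply: (le_trans (lerD (ler_normB _ _) (lexx _))); rewrite normrN.
  have := normr_ge0 (a0 - b0); have := normr_ge0 (a1 - b1).
  by have := normr_ge0 (a2 - b2); lra.
rewrite -(real_normK (num_real D)) -(real_normK (num_real (a0 - b0))).
rewrite -(real_normK (num_real (a1 - b1))) -(real_normK (num_real (a2 - b2))).
move: H; set u := `|a0 - b0|; set v := `|a1 - b1|; set w := `|a2 - b2| => H.
apply: (@le_trans _ _ ((41 * (u + v + w)) ^+ 2)).
  by rewrite ler_pXn2r// ?nnegrE// (le_trans _ H).
by have := sqr_ge0 (u - v); have := sqr_ge0 (v - w); have := sqr_ge0 (u - w); nra.
Qed.

Lemma sum_gap2 x y : \sum_(i < d) gap2 x y i.+1 = enorm (x - y) ^+ 2.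
Proof.
rewrite /enorm sqr_sqrtr ?sumr_ge0// => [|i _]; last exact: sqr_ge0.
by apply: eq_bigr => i _; rewrite /gap2 !padded_ord !mxE.
Qed.

(** Summing the entrywise bounds counts every coordinate at most three times, and the padding is the
    same for x and y; hence 41^2 * 3 * 3 = 123^2, whatever the dimension. *)
Lemma dchain_lipschitz x y :
  enorm (dchain x - dchain y) <= 123 * enorm (x - y).
Proof.
have e0 : 0 <= enorm (x - y) by exact: sqrtr_ge0.
have g0 k : 0 <= gap2 x y k by exact: sqr_ge0.
rewrite -(@ler_pXn2r _ 2)// ?nnegrE ?sqrtr_ge0 ?mulr_ge0//.
rewrite [leLHS]sqr_sqrtr ?sumr_ge0// => [|i _]; last exact: sqr_ge0.
rewrite exprMn -sum_gap2.
apply: (@le_trans _ _ (\sum_(j < d) 41 ^+ 2 * 3 *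
    (gap2 x y j + gap2 x y j.+1 + gap2 x y j.+2))).
  by apply: ler_sum => j _; rewrite mxE [(- _ : 'rV_d) _ _]mxE dchain_lipschitz_coord.
rewrite -mulr_sumr !big_split/=.
set S := \sum_(i < d) gap2 x y i.+1.
have H0 : \sum_(i < d) gap2 x y i <= S.
  apply: (@le_trans _ _ (\sum_(i < d.+1) gap2 x y i)).
    by rewrite big_ord_recr/= lerDl.
  by rewrite big_ord_recl/= /gap2/padded subrr expr0n add0r.
have H2 : \sum_(i < d) gap2 x y i.+2 <= S.
  apply: (@le_trans _ _ (\sum_(i < d.+1) gap2 x y i.+1)).
    by rewrite big_ord_recl/= lerDr.
  by rewrite big_ord_recr/= /gap2 !padded_ge// subrr expr0n addr0.
by lra.
Qed.

Lemma chain_lb x : - (9 * d%:R) <= chain x.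
Proof.
have -> : - (9 * d%:R) = \sum_(i < d) (- 9 : R).
  by rewrite sumr_const card_ord mulNrn mulr_natr.
apply: ler_sum => i _.
rewrite /link.
have r01 : (0 : R) < 1 by lra. have r03 : (0 : R) < 3 by lra.
have := hinge_ge0 (- padded x i.+1).
have := step_ge0 (padded x i) r01; have := step_le (padded x i) r01.
have := step_ge0 (padded x i.+1) r03; have := step_le (padded x i.+1) r03.
by nra.
Qed.

Lemma chain0_le0 : chain 0 <= 0.
Proof.
apply: sumr_le0 => i _; rewrite /link padded_ord mxE oppr0 /hinge relu_eq0//.
by rewrite expr0n mul0r sub0r oppr_le0 mulr_ge0 ?step_ge0//; lra.
Qed.

(** [step 1] is flat up to 0 and the barrier has slope 0 at 0, so two consecutive zeros block the
    chain. *)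
Lemma dchain_eq0 x (j : 'I_d) :
  padded x j = 0 -> padded x j.+1 = 0 -> dchain x 0 j = 0.
Proof.
move=> h0 h1; rewrite mxE h0 h1 oppr0 relu_eq0// [step 1 0]step_eq0 ?[dstep 1 0]dstep_eq0; [|lra..].
by rewrite !mul0r oppr0 !addr0.
Qed.

Lemma dchain_frontier x (j : 'I_d) : padded x j.+1 = 0 -> `|dchain x 0 j| <= 3.
Proof.
move=> h1; rewrite mxE h1 oppr0 relu_eq0// [dstep 1 0]dstep_eq0; [|lra..].
rewrite oppr0 mul0r subr0 sub0r normrN normrM.
have r01 : (0 : R) < 1 by lra. have r03 : (0 : R) < 3 by lra.
rewrite !ger0_norm ?step_ge0 ?dstep_ge0//.
have := step_ge0 (padded x j) r01; have := step_le (padded x j) r01.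
by have := dstep_ge0 0 r03; have := dstep_le 0 r03; nra.
Qed.

End Chain.

(** * Guessing keys one at a time *)

Section SeedGuessing.
Variables (d n : nat).
Local Notation keys := {ffun 'I_d -> 'I_n}.
Variable guess : keys -> nat -> 'I_n.

(** The key under attack is the one of index [progress p r]; the existential rules out any hit once
    all d keys are found. *)
Fixpoint progress (p : keys) (s : nat) : nat :=
  if s is r.+1 then
    progress p r + [exists i : 'I_d, (i == progress p r :> nat) && (p i == guess p r)]
  else 0.

Definition hit (p : keys) (s : nat) : bool :=
  [exists i : 'I_d, (i == progress p s :> nat) && (p i == guess p s)].

Lemma progressS p s : progress p s.+1 = (progress p s + hit p s)%N.
Proof. by []. Qed.

Lemma hitE p s (i : 'I_d) : progress p s = i -> hit p s = (p i == guess p s).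
Proof.
move=> pi; apply/existsP/idP => [[j /andP[/eqP ji]]|pg].
  by have -> : j = i by apply/val_inj; rewrite /= ji pi.
by exists i; rewrite pi eqxx.
Qed.

Lemma hit_lt p s : hit p s -> (progress p s < d)%N.
Proof. by case/existsP => i /andP[/eqP <- _]. Qed.

Lemma progress_le p s : (progress p s <= d)%N.
Proof.
elim: s => // s IH; rewrite progressS.
by case: (boolP (hit p s)) => [/hit_lt|_]; rewrite ?addn1 ?addn0.
Qed.

Lemma leq_progress p s t : (s <= t)%N -> (progress p s <= progress p t)%N.
Proof.
elim: t => [|t IH]; first by rewrite leqn0 => /eqP->.
rewrite leq_eqVlt => /orP[/eqP->//|/IH h].
by rewrite progressS (leq_trans h)// leq_addr.
Qed.

Lemma progress_card p t : progress p t = #|[set s : 'I_t | hit p s]%SET|.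
Proof.
rewrite cardsE -sum1_card big_mkcond/=.
elim: t => [|t IH]; first by rewrite big_ord0.
by rewrite big_ord_recr/= -IH /in_mem/= -/(hit p t); case: (hit p t).
Qed.

Lemma eq_progress p q s : (forall r, (r < s)%N -> hit p r = hit q r) ->
  progress p s = progress q s.
Proof.
elim: s => // s IH h; rewrite !progressS h// IH// => r rs.
by apply: h; rewrite ltnS ltnW.
Qed.

(** Everything that s rounds can reveal about the keys: the pattern of hits and the keys already
    found. *)
Definition agree (p q : keys) (s : nat) : Prop :=
  (forall r, (r < s)%N -> hit p r = hit q r) /\
  (forall i : 'I_d, (i < progress p s)%N -> p i = q i).

Hypothesis guess_agree : forall p q s, agree p q s -> guess p s = guess q s.

(** Induction on rounds: equal patterns so far force equal guesses, and at a hit the new key is that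
    common guess. *)
Lemma hits_determine p q t : (forall s, (s < t)%N -> hit p s = hit q s) ->
  progress p t = progress q t /\ forall i : 'I_d, (i < progress p t)%N -> p i = q i.
Proof.
elim: t => [//|t IH] hpq.
have [e pq] := IH (fun s st => hpq s (ltnW st)).
have g : guess p t = guess q t.
  by apply: guess_agree; split=> // r rt; apply: hpq; rewrite ltnS ltnW.
have h := hpq t (ltnSn t).
split=> [|i]; first by rewrite !progressS e h.
rewrite progressS; case: (boolP (hit p t)) => [hp|_]; last by rewrite addn0; exact: pq.
rewrite addn1 ltnS leq_eqVlt => /orP[/eqP ip|]; last exact: pq.
have hq : hit q t by rewrite -h.
have := hp; rewrite (hitE (esym ip)) => /eqP ->.
by move: hq; rewrite (@hitE _ _ i) -?e// => /eqP->.
Qed.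

(** The set of hit rounds is a code, injective on the key vectors found completely, with values in
    the d-element sets of rounds. *)
Lemma card_complete t : (#|[set p | progress p t == d]%SET| <= 'C(t, d))%N.
Proof.
pose code p : {set 'I_t} := [set s : 'I_t | hit p s]%SET.
rewrite -[t in 'C(t, _)]card_ord -card_draws -(card_in_imset (f := code)).
  apply/subset_leq_card/fintype.subsetP => _ /imsetP[p + ->].
  by rewrite !inE -progress_card.
move=> p q; rewrite !inE => /eqP pt /eqP qt /setP pq.
have hpq s : (s < t)%N -> hit p s = hit q s.
  by move=> st; have := pq (Ordinal st); rewrite !inE.
have [_ H] := hits_determine hpq.
by apply/ffunP => i; apply: H; rewrite pt.
Qed.

End SeedGuessing.

(** * A binomial estimate *)

(** The product (m + 1) ... (2m) is at least m^m and equals m! times a binomial coefficient, which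
    is at most 2^(2m). *)
Lemma expn_fact_leq m : (m ^ m <= 4 ^ m * m`!)%N.
Proof.
have h1 : ('C(m + m, m) <= 2 ^ (m + m))%N.
  have mm : (m < (m + m).+1)%N by rewrite ltnS leq_addr.
  rewrite -[2%N]/(1 + 1)%N expnDn (bigD1 (Ordinal mm))//=.
  by rewrite !exp1n !muln1 leq_addr.
have h2 : (m ^ m <= (m + m) ^_ m)%N.
  have H k : (k <= m -> m ^ k <= (m + m) ^_ k)%N.
    elim: k => [//|k IH] km; rewrite expnSr ffactnSr leq_mul ?IH ?(ltnW km)//.
    by rewrite -addnBA ?(ltnW km)// leq_addr.
  exact: H.
apply: (leq_trans h2); rewrite -bin_ffact leq_mul2r -[4%N]/(2 ^ 2)%N -expnM mul2n -addnn.
by rewrite h1 orbT.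
Qed.

(** 8^d C(t,d) d! <= (8t)^d <= d^d n^d <= 4^d d! n^d, so C(t,d) <= (n/2)^d; one factor 2 is kept
    since d > 0. *)
Lemma bin_le_half_expn t d n : (0 < d)%N -> (8 * t <= d * n)%N ->
  (2 * 'C(t, d) <= n ^ d)%N.
Proof.
move=> d0 tdn.
have h : ('C(t, d) * d`! <= t ^ d)%N.
  rewrite bin_ffact; elim: d {d0 tdn} => // d IH.
  by rewrite ffactnSr expnSr leq_mul// leq_subr.
have h8 : (8 ^ d * ('C(t, d) * d`!) <= 4 ^ d * n ^ d * d`!)%N.
  rewrite (leq_trans (leq_mul (leqnn _) h))// -expnMn.
  apply: (@leq_trans ((d * n) ^ d)); first by rewrite leq_exp2r.
  by rewrite expnMn mulnAC leq_mul2r expn_fact_leq orbT.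
have h2 : (2 ^ d * 'C(t, d) <= n ^ d)%N.
  rewrite -(leq_pmul2l (_ : 0 < 4 ^ d)%N) ?expn_gt0// mulnA -expnMn.
  by rewrite -(leq_pmul2r (fact_gt0 d)) -mulnA.
apply: leq_trans h2; rewrite leq_mul2r; apply/orP; right.
by rewrite -[2%N in X in (X <= _)%N]expn1 leq_pexp2l.
Qed.

(** * Measurability of values and gradients *)

(** Gluing along a countable measurable partition. The index c may take values in a type without
    sigma-algebra, such as grid cells or seeds. *)
Lemma measurable_fun_countable_cases d1 d2 (T : measurableType d1)
    (S : measurableType d2) (C : countType) (c : T -> C) (g : C -> T -> S) (f : T -> S) :
  (forall k, measurable (c @^-1` [set k])) ->
  (forall k, measurable_fun setT (g k)) ->
  (forall t, f t = g (c t) t) -> measurable_fun setT f.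
Proof.
move=> mc mg fg _ B mB; rewrite setTI.
have -> : f @^-1` B = \bigcup_(k : C) (c @^-1` [set k] `&` g k @^-1` B).
  apply/seteqP; split=> [t /= ft|t [k _ [/= ck gt]]].
    by exists (c t) => //; split=> //=; rewrite -fg.
  by rewrite /= fg ck.
apply: countable_bigcupT_measurable => [|k]; first exact: countableP.
by apply: measurableI => //; rewrite -[_ @^-1` _]setTI; exact: mg.
Qed.

Section Measurability.
Variables (R : realType) (d : nat) (Delta L : {posnum R}).
Local Notation rV := (borel_rV R d).
Local Notation FS := (fclass_space d Delta L).

Lemma measurable_coord (i : 'I_d) :
  measurable_fun setT (fun x : rV => (x : 'rV[R]_d) 0 i).
Proof.
move=> _ B mB; apply: sub_sigma_algebra; exists i => //.
by exists B => //; rewrite setTI.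
Qed.

Lemma measurable_rV dT (T : measurableType dT) (f : T -> rV) :
  (forall i : 'I_d, measurable_fun setT (fun t => (f t : 'rV[R]_d) 0 i)) ->
  measurable_fun setT f.
Proof.
move=> mf; apply: (@measurability _ _ T rV setT f (@coordinate_sets R d) erefl).
by move=> _ [_ [i _ [B mB <-]] <-]; rewrite !setTI -comp_preimage -[_ @^-1` _]setTI; exact: mf.
Qed.

Lemma measurable_eval_at (x : 'rV[R]_d) : measurable_fun setT (fun F : FS => F x).
Proof.
move=> _ B mB; apply: sub_sigma_algebra; exists x => //.
by exists B => //; rewrite setTI.
Qed.

(* By continuity F x is the limit of the values of F at the corners of the cells
   containing x: countably many points, at each of which evaluation is
   measurable. *)
Definition grid (n : nat) (k : {ffun 'I_d -> int}) : 'rV[R]_d :=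
  \row_i ((k i)%:~R / n.+1%:R).

Definition cell (n : nat) (x : 'rV[R]_d) : {ffun 'I_d -> int} :=
  [ffun i => Num.floor (n.+1%:R * x 0 i)].

Lemma measurable_cell n k : measurable ((@cell n : rV -> _) @^-1` [set k]).
Proof.
have -> : (@cell n : rV -> _) @^-1` [set k] = \bigcap_(i : 'I_d)
    ((fun x : rV => n.+1%:R * (x : 'rV[R]_d) 0 i) @^-1` `[(k i)%:~R, (k i + 1)%:~R[).
  apply/seteqP; split=> [x /= <- i _|x /= H].
    by rewrite /= in_itv/= ffunE floor_itv.
  apply/ffunP => i; have := H i I; rewrite /= in_itv/= ffunE => xk.
  exact: floor_def.
apply: fin_bigcap_measurable => // i _.
rewrite -[_ @^-1` _]setTI; apply: measurable_funM => //; exact: measurable_coord.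
Qed.

Lemma cvg_grid (x : 'rV[R]_d) : grid n (cell n x) @[n --> \oo] --> x.
Proof.
apply/cvg_ballP => e e0; near=> n; split=> // i j.
rewrite /ball/= !mxE ord1 ffunE.
have n0 : (0 : R) < n.+1%:R by rewrite ltr0n.
have ne : n.+1%:R^-1 < e by near: n; exact: near_infty_natSinv_lt (PosNum e0).
apply: le_lt_trans ne.
have /andP[] := floor_itv (n.+1%:R * x 0 j); set k := Num.floor _.
rewrite intrD -ler_pdivrMl// -ltr_pdivlMl// mulrDr mulr1 mulrC => h1 h2.
by rewrite ger0_norm ?subr_ge0// lerBlDr addrC ltW.
Unshelve. all: by end_near.
Qed.

Lemma measurable_eval : measurable_fun setT (fun u : FS * rV => (u.1 : fclass d Delta L) u.2).
Proof.
have := @measurable_fun_cvg _ (FS * rV)%type R setT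
  (fun n u => (u.1 : fclass d Delta L) (grid n (cell n u.2)))
  (fun u => (u.1 : fclass d Delta L) u.2).
apply.
  move=> n; apply: (@measurable_fun_countable_cases _ _ _ _ _
    (fun u : FS * rV => cell n u.2) (fun k u => (u.1 : fclass d Delta L) (grid n k))) => // k.
    have -> : (fun u : FS * rV => cell n u.2) @^-1` [set k]
       = snd @^-1` ((@cell n : rV -> _) @^-1` [set k]) by [].
    by rewrite -[X in measurable X]setTI; apply: measurable_snd => //; exact: measurable_cell.
  apply: (@measurableT_comp _ _ _ _ _ _ (fun F : FS => (F : fclass d Delta L) (grid n k))) => //.
  exact: measurable_eval_at.
move=> [F x] _ /=; apply: (cvg_comp (fun n => grid n (cell n x)) F (@cvg_grid x)).
exact/differentiable_continuous/fclass_diff.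
Qed.

(** A derivative is the limit of difference quotients along 1/(n+1), which are measurable because
    evaluation is jointly measurable. *)
Lemma measurable_grad_coord (i : 'I_d) :
  measurable_fun setT (fun u : FS * rV => 'D_(delta_mx 0 i) (u.1 : fclass d Delta L) u.2).
Proof.
pose h n : R := n.+1%:R^-1.
apply: (@measurable_fun_cvg _ _ _ _ (fun n (u : FS * rV) =>
   (h n)^-1 * ((u.1 : fclass d Delta L) (h n *: delta_mx 0 i + (u.2 : 'rV[R]_d))
      - (u.1 : fclass d Delta L) u.2))).
  move=> n; apply: measurable_funM => //; apply: measurable_funB; last exact: measurable_eval.
  apply: (@measurableT_comp _ _ _ _ _ _ (fun u : FS * rV => (u.1 : fclass d Delta L) u.2)
     _ (fun u : FS * rV => (u.1, (h n *: delta_mx 0 i + (u.2 : 'rV[R]_d)) : rV))).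
    exact: measurable_eval.
  apply: measurable_fun_pair => //; apply: measurable_rV => j.
  under eq_fun => u do rewrite !mxE.
  apply: measurable_funD => //.
  exact: (measurableT_comp (@measurable_coord j) measurable_snd).
move=> [F x] _ /=.
have : derivable F x (delta_mx 0 i : 'rV[R]_d).
  by apply: diff_derivable; exact: fclass_diff.
rewrite /derivable => /cvg_ex[l Fl].
have -> : 'D_(delta_mx 0 i) F x = l by apply: cvg_lim.
have h0 : h @ \oo --> (0 : R)^'.
  move=> A A0; have H := @cvg_harmonic R [set y | y != 0 -> A y] A0.
  apply: (@filterS _ \oo _ (harmonic @^-1` [set y | y != 0 -> A y])) H => n; apply.
  by rewrite /= invr_eq0 pnatr_eq0.
exact: (cvg_comp h _ h0 Fl).
Qed.

End Measurability.

(** * Random oracles with hidden keys *)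

Section UniformNat.
Local Open Scope ereal_scope.
Variables (R : realType) (K : nat).

(** The uniform law on 0, ..., K. Keys are drawn through their rank in an enumeration, so that the
    outcomes form a discrete space. *)
Definition uniform_nat : set nat -> \bar R :=
  mscale (K.+1%:R^-1 : R)%:nng%R (msum (fun i => \d_i) K.+1).

HB.instance Definition _ := Measure.on uniform_nat.

Let uniform_nat_setT : uniform_nat setT = 1.
Proof.
rewrite /uniform_nat /mscale /msum/=.
have -> : msum (fun i : nat => \d_i : {measure set nat -> \bar R}) K.+1 [set: nat]
    = \sum_(i < K.+1) 1%:E.
  by apply: eq_bigr => i _; exact: diracT.
rewrite sumEFin sumr_const card_ord -EFinM.
by rewrite mulVf ?pnatr_eq0.
Qed.

HB.instance Definition _ :=
  Measure_isProbability.Build _ _ R uniform_nat uniform_nat_setT.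

Lemma integral_uniform_nat (f : nat -> \bar R) : (forall i, 0 <= f i) ->
  \int[uniform_nat]_i f i = (K.+1%:R^-1)%R%:E * \sum_(i < K.+1) f i.
Proof.
move=> f0; rewrite ge0_integral_mscale//=; congr (_ * _).
rewrite ge0_integral_measure_sum//; apply: eq_bigr => i _.
by rewrite integral_dirac// diracT mul1e.
Qed.

End UniformNat.

Section KeyedOracle.
Variables (R : realType) (d : nat) (Delta L sigma2 : {posnum R}) (n : nat).
Local Notation FC := (fclass d Delta L).
Local Notation FS := (fclass_space d Delta L).
Local Notation keys := {ffun 'I_d -> 'I_n.+1}.
Implicit Types (F : FC) (x : 'rV[R]_d) (p : keys).

(** This holds at every index past the last nonzero coordinate, not only at the first one; for the
    hard function the derivatives at the others vanish. *)
Definition frontier x (i : 'I_d) : bool :=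
  [forall j : 'I_d, (i <= j)%N ==> (x 0 j == 0)].

(* Hiding the frontier coordinates costs exactly this variance; where it is too
   large the oracle answers with the exact gradient. *)
Definition tame F x : bool :=
  n%:R * (\sum_(i < d) (frontier x i)%:R * grad F x 0 i ^+ 2) <= sigma2%:num.

Definition keyed_grad p F x (z : 'I_n.+1) : 'rV[R]_d :=
  \row_i (grad F x 0 i *
    (if tame F x && frontier x i then n.+1%:R * (p i == z)%:R else 1)).

Lemma sum_key p i : \sum_(z < n.+1) (p i == z)%:R = 1 :> R.
Proof.
rewrite (bigD1 (p i))//= eqxx big1 ?addr0// => z /negPf.
by rewrite eq_sym => ->.
Qed.

Lemma keyed_unbiased p F x :
  (n.+1%:R)^-1 *: \sum_(z < n.+1) keyed_grad p F x z = grad F x.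
Proof.
apply/rowP => i; rewrite mxE summxE.
under eq_bigr => z _ do rewrite mxE.
rewrite -mulr_sumr; case: (tame F x && frontier x i).
  by rewrite -mulr_sumr sum_key mulr1 mulrCA mulVf ?mulr1 ?pnatr_eq0.
by rewrite sumr_const card_ord mulrCA mulVf ?mulr1 ?pnatr_eq0.
Qed.

(** With N = n.+1, the variable N 1[p_i = z] has mean 1 and variance N - 1 = n, which is the factor
    in [tame]. *)
Lemma keyed_variance p F x :
  (n.+1%:R)^-1 * \sum_(z < n.+1) enorm (keyed_grad p F x z - grad F x) ^+ 2
    <= sigma2%:num.
Proof.
have E (z : 'I_n.+1) : enorm (keyed_grad p F x z - grad F x) ^+ 2 =
    \sum_(i < d) (if tame F x && frontier x i then
       grad F x 0 i ^+ 2 * (n.+1%:R * (p i == z)%:R - 1) ^+ 2 else 0).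
  rewrite /enorm sqr_sqrtr ?sumr_ge0// => [|i _]; last exact: sqr_ge0.
  apply: eq_bigr => i _; rewrite mxE [X in _ + X]mxE [X in X + _]mxE.
  case: ifP => _; last by rewrite mulr1 subrr expr0n.
  by rewrite -exprMn mulrBr mulr1.
under eq_bigr => z _ do rewrite E.
rewrite exchange_big/= mulr_sumr.
have H i : n.+1%:R^-1 * \sum_(z < n.+1) (if tame F x && frontier x i then
       grad F x 0 i ^+ 2 * (n.+1%:R * (p i == z)%:R - 1) ^+ 2 else 0)
   = if tame F x then n%:R * ((frontier x i)%:R * grad F x 0 i ^+ 2) else 0.
  case: (tame F x) => /=; last by rewrite big1_eq mulr0.
  case: (frontier x i); last by rewrite big1_eq mul0r !mulr0.
  rewrite -mulr_sumr mul1r.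
  have -> : \sum_(z < n.+1) (n.+1%:R * (p i == z)%:R - 1) ^+ 2 =
      \sum_(z < n.+1) ((n.+1%:R ^+ 2 - n.+1%:R * 2) * (p i == z)%:R + 1) :> R.
    by apply: eq_bigr => z _; case: (p i == z); rewrite ?mulr1 ?mulr0; ring.
  rewrite big_split/= -mulr_sumr sum_key sumr_const card_ord mulr1.
  rewrite -[n.+1]addn1 natrD; field.
  by rewrite natr1 pnatr_eq0.
under eq_bigr => i _ do rewrite H.
case: (boolP (tame F x)) => [t|_]; last by rewrite big1_eq.
by rewrite -mulr_sumr.
Qed.

Definition keyed_oracle p : oracle d Delta L sigma2 :=
  Oracle (keyed_unbiased p) (keyed_variance p).

(** As the vanishing of a sum of squares, the condition becomes an equality between measurable real
    functions. *)
Lemma frontierE x i : frontier x i = (\sum_(j < d | (i <= j)%N) x 0 j ^+ 2 == 0).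
Proof.
rewrite psumr_eq0 => [|j _]; last exact: sqr_ge0.
apply/forallP/allP => [H j _|H j]; first by rewrite sqrf_eq0; exact: H.
by have := H j (mem_index_enum j); rewrite sqrf_eq0.
Qed.

Local Notation rV := (borel_rV R d).

Lemma measurable_frontier i :
  measurable_fun setT (fun u : FS * rV => frontier u.2 i).
Proof.
under eq_fun => u do rewrite frontierE big_mkcond/=.
apply: measurable_fun_eqr => //.
apply: measurable_sum => j; case: (i <= j)%N => //.
by apply: measurable_funX; exact: (measurableT_comp (@measurable_coord _ _ j) measurable_snd).
Qed.

Lemma measurable_grad0 i :
  measurable_fun setT (fun u : FS * rV => grad (u.1 : FC) u.2 0 i).
Proof.
under eq_fun => u do rewrite mxE.
exact: measurable_grad_coord.
Qed.

Lemma measurable_tame : measurable_fun setT (fun u : FS * rV => tame u.1 u.2).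
Proof.
apply: measurable_fun_ler => //; apply: measurable_funM => //.
apply: measurable_sum => i; apply: measurable_funM; last first.
  by apply: measurable_funX; exact: measurable_grad0.
have -> : (fun u : FS * rV => (frontier u.2 i)%:R) =
    fun u : FS * rV => if frontier u.2 i then 1 else 0 : R.
  by apply/funext => u; case: frontier.
by apply: measurable_fun_ifT => //; exact: measurable_frontier.
Qed.

Lemma measurable_keyed_grad p z :
  measurable_fun setT (fun u : FS * rV => keyed_grad p u.1 u.2 z : rV).
Proof.
apply: measurable_rV => i; under eq_fun => u do rewrite mxE.
apply: measurable_funM; first exact: measurable_grad0.
apply: measurable_fun_ifT => //.
by apply: measurable_and; [exact: measurable_tame|exact: measurable_frontier].
Qed.

Definition key (w : nat) : keys := nth [ffun=> ord0] (enum {: keys}) w.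

Lemma measurable_key_seeds :
  measurable_fun setT (fun w : nat => oracle_seeds (keyed_oracle (key w))).
Proof. exact: measurable_cst. Qed.

Lemma measurable_key_grad (z : nat) :
  measurable_fun setT (fun u : nat * FS * rV =>
    oracle_grad (keyed_oracle (key u.1.1)) u.1.2 u.2 (inord z) : rV).
Proof.
apply: (@measurable_fun_countable_cases _ _ _ _ _ (fun u : nat * FS * rV => u.1.1)
   (fun w u => keyed_grad (key w) u.1.2 u.2 (inord z) : rV)) => // w.
  rewrite (_ : _ @^-1` _ = fst @^-1` (fst @^-1` [set w]))//.
  rewrite -[X in measurable X]setTI; apply: measurable_fst => //.
  by rewrite -[X in measurable X]setTI; apply: measurable_fst.
apply: (@measurableT_comp _ _ _ _ _ _ (fun u : FS * rV => keyed_grad (key w) u.1 u.2 (inord z) : rV) _ (fun u : nat * FS * rV => (u.1.2, u.2))).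
  exact: measurable_keyed_grad.
apply: measurable_fun_pair => //.
exact: (measurableT_comp measurable_snd measurable_fst).
Qed.

(** [uniform_nat R K] has K.+1 atoms, hence the predecessor; ranks outside the enumeration have
    measure 0. *)
Definition keyed_distribution : oracle_distribution d Delta L sigma2 :=
  @OracleDistribution R d Delta L sigma2 _ _ (uniform_nat R #|{: keys}|.-1)
    (fun w => keyed_oracle (key w)) measurable_key_seeds measurable_key_grad.

End KeyedOracle.

Arguments key {d n} w.
Arguments keyed_oracle {R d Delta L} sigma2 {n} p.

(** * Runs of an algorithm *)

Lemma measurable_rcons dT (T : measurableType dT) dS (S : measurableType dS) t
    (h : T -> t.-tuple S) (a : T -> S) :
  measurable_fun setT h -> measurable_fun setT a ->
  measurable_fun setT (fun w => [tuple of rcons (h w) (a w)]).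
Proof.
move=> mh ma; apply/measurable_fun_tnthP => i.
have [it|it] := ltnP i t.
  have -> : (@tnth t.+1 S)^~ i \o (fun w => [tuple of rcons (h w) (a w)])
      = (@tnth t S)^~ (Ordinal it) \o h.
    apply/funext => w /=; rewrite !(tnth_nth (a w))/= nth_rcons size_tuple.
    by rewrite it.
  exact: (measurableT_comp (measurable_tnth _) mh).
have -> : (@tnth t.+1 S)^~ i \o (fun w => [tuple of rcons (h w) (a w)]) = a.
  apply/funext => w /=; rewrite (tnth_nth (a w))/= nth_rcons size_tuple.
  by rewrite ltnNge it/=; case: ifP.
exact: ma.
Qed.

Section RunMeasurability.
Variables (R : realType) (d : nat) (Delta L sigma2 : {posnum R}).
Local Notation FC := (fclass d Delta L).
Local Notation FS := (fclass_space d Delta L).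
Local Notation rV := (borel_rV R d).
Local Notation response := (R * rV)%type.
Variables (A : algorithm R d) (O : oracle d Delta L sigma2).
Hypothesis measurable_oracle : forall z,
  measurable_fun setT (fun u : FS * rV => oracle_grad O u.1 u.2 z : rV).
Local Notation N := (oracle_seeds O).
Local Notation W := (FS * alg_space A)%type.

Lemma measurable_history t :
  measurable_fun setT (fun w : W => history O (w.1 : FC) w.2 t).
Proof.
elim: t => [|t IH] /=; first exact: measurable_cst.
apply: measurable_rcons => //.
have mrh : measurable_fun setT (fun w : W => (w.2, history O (w.1 : FC) w.2 t)).
  exact: measurable_fun_pair.
have mFx : measurable_fun setT (fun w : W =>
    (w.1, alg_point A N t (w.2, history O (w.1 : FC) w.2 t)) : FS * rV).
  apply: measurable_fun_pair => //.
  exact: (measurableT_comp (@alg_measurable_point _ _ A N t) mrh).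
apply: measurable_fun_pair.
  exact: (measurableT_comp (@measurable_eval R d Delta L) mFx).
(* The proposed seed is fixed on each of finitely many measurable events, and for a fixed seed the
   answer is measurable. *)
apply: (@measurable_fun_countable_cases _ _ _ _ _
   (fun w : W => alg_seed A N t (w.2, history O (w.1 : FC) w.2 t))
   (fun z w => oracle_grad O (w.1 : FC) (alg_point A N t (w.2, history O (w.1 : FC) w.2 t)) z : rV)) => // z.
  have := mrh measurableT _ (@alg_measurable_seed _ _ A N t z).
  by rewrite setTI.
exact: (measurableT_comp (measurable_oracle z) mFx).
Qed.

Lemma measurable_enorm_grad : measurable_fun setT (fun u : FS * rV =>
  enorm (grad (u.1 : FC) u.2)).
Proof.
apply: measurableT_comp; first by apply: continuous_measurable_fun; exact: sqrt_continuous.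
by apply: measurable_sum => i; apply: measurable_funX; exact: measurable_grad0.
Qed.

Lemma measurable_enorm_grad_query t :
  measurable_fun setT (fun w : W =>
    enorm (grad (w.1 : FC) (query_point O (w.1 : FC) w.2 t))).
Proof.
apply: (measurableT_comp measurable_enorm_grad (g := fun w : W => (w.1, query_point O (w.1 : FC) w.2 t : rV))).
apply: measurable_fun_pair => //.
apply: (measurableT_comp (@alg_measurable_point _ _ A N t)).
by apply: measurable_fun_pair => //; exact: measurable_history.
Qed.

End RunMeasurability.

(** * The expected gradient as an average over the keys *)

(** The third variable, the randomness of the algorithm, goes outermost: the lower bound holds for
    each of its values. *)
Lemma tonelli3 (R : realType) (d1 d2 d3 : measure_display)
    (T1 : measurableType d1) (T2 : measurableType d2) (T3 : measurableType d3)
    (P1 : probability T1 R) (P2 : probability T2 R) (P3 : probability T3 R)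
    (f : T1 * T2 * T3 -> \bar R) :
  measurable_fun setT f -> (forall w, (0 <= f w)%E) ->
  (\int[(P1 \x P2) \x P3]_w f w = \int[P3]_z \int[P1]_x \int[P2]_y f (x, y, z))%E.
Proof.
move=> mf f0.
(* Sigma-finiteness of a product of probabilities is only inferred through its
   structure of probability. *)
pose P12 : probability (T1 * T2)%type R := (P1 \x P2)%E.
transitivity (\int[P12 \x P3]_w f w)%E; first by [].
rewrite (fubini_tonelli2 f mf f0); apply: eq_integral => z _.
rewrite /fubini_G; apply: (fubini_tonelli1 (fun v => f (v, z))) => //.
exact: measurable_fun_pair1.
Qed.

Section ExpectedGradientTonelli.
Variables (R : realType) (d : nat) (Delta L sigma2 : {posnum R}).
Local Notation FS := (fclass_space d Delta L).
Local Open Scope ereal_scope.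

Lemma expected_grad_tonelli (PO : oracle_distribution d Delta L sigma2)
    (PF : probability FS R) (A : algorithm R d) t :
  let f (w : od_space PO * FS * alg_space A) :=
    enorm (grad (w.1.2 : fclass d Delta L)
      (query_point (od_oracle w.1.1) w.1.2 w.2 t)) in
  measurable_fun setT f ->
  expected_grad PO PF A t =
  \int[alg_prob A]_r \int[od_prob PO]_w \int[PF]_F (f (w, F, r))%:E.
Proof.
move=> f /measurable_EFinP mf.
by rewrite /expected_grad (tonelli3 _ _ _ mf)// => w; rewrite lee_fin enorm_ge0.
Qed.

End ExpectedGradientTonelli.

Section ExpectedGradient.
Variables (R : realType) (d : nat) (Delta L sigma2 : {posnum R}) (n : nat).
Local Notation FC := (fclass d Delta L).
Local Notation FS := (fclass_space d Delta L).
Local Notation keys := {ffun 'I_d -> 'I_n.+1}.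
Local Open Scope ereal_scope.

Lemma sum_key_enum (f : keys -> \bar R) :
  \sum_(w < #|{: keys}|.-1.+1) f (key w) = \sum_p f p.
Proof.
have K0 : (0 < #|{: keys}|)%N by apply/card_gt0P; exists [ffun=> ord0].
rewrite prednK// -[RHS]big_enum/= (big_nth [ffun=> ord0]) -cardE big_mkord.
by [].
Qed.

Lemma expected_grad_keyed (A : algorithm R d) (F : FC) t :
  expected_grad (keyed_distribution d Delta L sigma2 n) (\d_(F : FS)) A t
  = \int[alg_prob A]_r ((#|{: keys}|%:R^-1)%R%:E *
      \sum_(p : keys) (enorm (grad F (query_point (keyed_oracle sigma2 p) F r t)))%:E).
Proof.
have mf : measurable_fun setT (fun w : nat * FS * alg_space A =>
    enorm (grad (w.1.2 : FC) (query_point (keyed_oracle sigma2 (key w.1.1 : keys)) w.1.2 w.2 t))).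
  apply: (@measurable_fun_countable_cases _ _ _ _ _ (fun w : nat * FS * alg_space A => w.1.1)
   (fun k w => (enorm (grad (w.1.2 : FC) (query_point (keyed_oracle sigma2 (key k : keys)) w.1.2 w.2 t))))) => // k.
    rewrite (_ : _ @^-1` _ = fst @^-1` (fst @^-1` [set k]))//.
    rewrite -[X in measurable X]setTI; apply: measurable_fst => //.
    by rewrite -[X in measurable X]setTI; apply: measurable_fst.
  have := @measurable_enorm_grad_query R d Delta L sigma2 A (keyed_oracle sigma2 (key k : keys))
    (@measurable_keyed_grad _ _ _ _ _ _ _) t.
  move/measurableT_comp => /(_ _ _ setT (fun w : nat * FS * alg_space A => (w.1.2, w.2))); apply.
  apply: measurable_fun_pair => //.
  exact: (measurableT_comp measurable_snd measurable_fst).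
rewrite (expected_grad_tonelli (PO := keyed_distribution d Delta L sigma2 n) _ mf).
apply: eq_integral => r _.
rewrite integral_uniform_nat; last by move=> i; apply: integral_ge0 => G _; rewrite lee_fin enorm_ge0.
have K0 : (0 < #|{: keys}|)%N by apply/card_gt0P; exists [ffun=> ord0].
rewrite -sum_key_enum; congr (_ * _); first by rewrite prednK.
apply: eq_bigr => i _; rewrite integral_dirac ?diracT ?mul1e//.
by apply/measurable_EFinP; exact: (measurable_fun_pair2 _ (measurable_fun_pair1 _ mf)).
Qed.

End ExpectedGradient.

(** * Zero-respecting runs against the keyed oracles *)

Section Interaction.
Variables (R : realType) (d : nat) (Delta L sigma2 : {posnum R}) (n : nat).
Local Notation FC := (fclass d Delta L).
Local Notation FS := (fclass_space d Delta L).
Local Notation keys := {ffun 'I_d -> 'I_n.+1}.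
Implicit Types p q : keys.
Variable F : FC.
Hypothesis zero_chain : forall (x : 'rV[R]_d) (k : nat),
  (forall j : 'I_d, (k <= j)%N -> x 0 j = 0) ->
  forall i : 'I_d, (k < i)%N -> grad F x 0 i = 0.
Hypothesis tameF : forall x, tame sigma2 n F x.
Variable A : algorithm R d.
Hypothesis zrA : zero_respecting Delta L sigma2 A.
Local Notation O p := (@keyed_oracle R d Delta L sigma2 n p).

Section FixedSeed.
Variable r : alg_space A.

Definition run_guess (p : keys) (s : nat) : 'I_n.+1 :=
  alg_seed A n s (r, history (O p) F r s).

Local Notation prog := (progress run_guess).

Lemma tnth_history p t (s : 'I_t) :
  tnth (history (O p) F r t) s = @answer _ _ _ _ _ (O p) F (query_point (O p) F r s, run_guess p s).
Proof.
elim: t s => [[]//|t IH] s.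
have [st|st] := ltnP s t.
  rewrite -(IH (Ordinal st)) (tnth_nth (0, 0 : borel_rV R d)) [RHS](tnth_nth (0, 0 : borel_rV R d))/=.
  by rewrite nth_rcons size_tuple st.
have {st} -> : s = ord_max.
  by apply/val_inj/eqP => /=; rewrite eqn_leq st andbT -ltnS.
by rewrite (tnth_nth (0, 0 : borel_rV R d))/= nth_rcons size_tuple ltnn eqxx.
Qed.

(** On a point vanishing from index k on, one comparison of a key with the seed decides all that the
    answer shows from index k on. *)
Lemma keyed_gradE p (x : 'rV[R]_d) z (k : nat) (i : 'I_d) :
  (forall j : 'I_d, (k <= j)%N -> x 0 j = 0) -> (k <= i)%N ->
  keyed_grad sigma2 p F x z 0 i =
    if k == i then grad F x 0 i * (n.+1%:R * (p i == z)%:R) else 0.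
Proof.
move=> xk ki; rewrite mxE; have [ei|nei] := eqVneq k i.
  rewrite tameF (_ : frontier x i)//; apply/forallP => j; apply/implyP => ij.
  by rewrite xk// ei.
by rewrite (zero_chain xk) ?mul0r// ltn_neqAle nei.
Qed.

(** Strong induction on rounds. A nonzero coordinate i must occur in an earlier answer, whose query
    vanished from its progress on; this forces i to equal that progress and the guess to hit, after
    which the progress exceeds i. *)
Lemma query_support p s (i : 'I_d) :
  (prog p s <= i)%N -> query_point (O p) F r s 0 i = 0.
Proof.
elim/ltn_ind: s i => s IH i pi; apply/eqP; apply: contraT => xi.
have [s' _ /=] := zrA xi.
rewrite /supp/= tnth_history/= => /negP[]; apply/eqP.
have h := IH s' (ltn_ord s').
have ps : (prog p s'.+1 <= i)%N by rewrite (leq_trans _ pi)// leq_progress.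
have ps' : (prog p s' <= i)%N by rewrite (leq_trans _ ps)// leq_progress.
rewrite (keyed_gradE _ _ h)//; case: eqP => // e.
have := ps; rewrite progressS (hitE e) e; case: eqP => _; last by rewrite !mulr0.
by rewrite addn1 ltnn.
Qed.

(** An answer depends on the keys only through its gradient part: entries below the progress use
    keys already found, the entry at the progress depends on the hit alone, and later entries are
    0. *)
Lemma history_agree p q s : agree run_guess p q s ->
  history (O p) F r s = history (O q) F r s.
Proof.
elim: s => [//|s IH] [hits keys_eq].
have ag : agree run_guess p q s.
  split=> [t ts|i ip]; first by apply: hits; rewrite ltnS ltnW.
  by apply: keys_eq; rewrite (leq_trans ip)// leq_progress.
have eh := IH ag.
have ex : query_point (O p) F r s = query_point (O q) F r s.
  by rewrite /query_point/= eh.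
have ez : run_guess p s = run_guess q s by rewrite /run_guess/= eh.
have ep : prog p s = prog q s by apply: eq_progress => t ts; apply: ag.1.
apply/val_inj => /=.
congr rcons; first by rewrite eh.
rewrite -/(query_point (O p) F r s) -/(query_point (O q) F r s).
rewrite -/(run_guess p s) -/(run_guess q s) -ex -ez.
congr pair; apply/rowP => i /=.
have [ip|pi] := ltnP i (prog p s); first by rewrite !mxE ag.2.
have xp := @query_support p s.
rewrite !(keyed_gradE _ _ xp)//; case: eqP => // e.
have := hits s (ltnSn s); rewrite (hitE e) (@hitE _ _ run_guess q s i) -?ep// -ez.
by move=> ->.
Qed.

Lemma run_guess_agree p q s : agree run_guess p q s -> run_guess p s = run_guess q s.
Proof. by move=> /history_agree h; rewrite /run_guess/= h. Qed.

Variable m : R.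
Hypothesis m0 : 0 <= m.
Hypothesis large : forall x : 'rV[R]_d, (exists j, x 0 j = 0) -> m <= enorm (grad F x).
Hypothesis d0 : (0 < d)%N.

(** For at least half of the key vectors some key is still unknown at round t; the last coordinate
    of the query is then 0 and the gradient has norm at least m. *)
Lemma average_grad_ge t : (8 * t <= d * n.+1)%N ->
  m / 2 <= #|{: keys}|%:R^-1 *
    \sum_(p : keys) enorm (grad F (query_point (O p) F r t)).
Proof.
move=> td; set K := #|{: keys}|.
have KE : K = (n.+1 ^ d)%N by rewrite /K card_ffun !card_ord.
have K0 : (0 : R) < K%:R by rewrite ltr0n KE expn_gt0.
rewrite ler_pdivlMl//.
pose B := [set p | prog p t == d]%SET.
have B2 : (2 * #|B| <= K)%N.
  rewrite KE (leq_trans _ (bin_le_half_expn d0 td))// leq_mul2l.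
  by rewrite card_complete//; exact: run_guess_agree.
have : (2 * #|B|)%:R <= K%:R :> R by rewrite ler_nat.
rewrite natrM => {}B2.
have BC : (#|B| + #|~: B|)%:R = K%:R :> R by rewrite cardsC.
rewrite natrD in BC.
apply: (@le_trans _ _ (\sum_(p in ~: B) m)).
  have C2 : K%:R <= 2 * #|~: B|%:R :> R by lra.
  rewrite sumr_const -[leRHS]mulr_natr; move: (ler_wpM2l m0 C2); lra.
rewrite [leRHS](bigID (fun p => p \in ~: B))/= -[leLHS]addr0.
apply: lerD; last by apply: sumr_ge0 => p _; exact: enorm_ge0.
apply: ler_sum => p; rewrite !inE => pB; apply: large.
have pd : (prog p t < d)%N by rewrite ltn_neqAle pB progress_le.
have dd : (d.-1 < d)%N by rewrite prednK.
exists (Ordinal dd); apply: query_support => /=.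
by rewrite -ltnS prednK.
Qed.

End FixedSeed.

Lemma expected_grad_ge m t : 0 <= m ->
  (forall x : 'rV[R]_d, (exists j, x 0 j = 0) -> m <= enorm (grad F x)) ->
  (0 < d)%N -> (8 * t <= d * n.+1)%N ->
  ((m / 2)%:E <= expected_grad (keyed_distribution d Delta L sigma2 n) (\d_(F : FS)) A t)%E.
Proof.
move=> m0 large d0 td; rewrite expected_grad_keyed.
rewrite -[leLHS]mule1 -(@probability_setT _ _ _ (alg_prob A)) -integral_cst//.
apply: ge0_le_integral => //=.
- by move=> r _; rewrite lee_fin divr_ge0.
- apply: measurable_funeM; apply: emeasurable_sum => p.
  apply/measurable_EFinP.
  apply: (@measurable_fun_pair2 _ _ _ _ _ _ (fun w : FS * alg_space A =>
    enorm (grad (w.1 : FC) (query_point (O p) (w.1 : FC) w.2 t)))).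
  by apply: measurable_enorm_grad_query => z; exact: measurable_keyed_grad.
- move=> r _; rewrite sumEFin -EFinM lee_fin.
  exact: average_grad_ge.
Qed.

End Interaction.

(** * The lower bound *)

Section HardFunction.
Variables (R : realType) (d : nat) (a b : R).
Implicit Types (x y : 'rV[R]_d).

Definition scaled_chain x : R := a * chain (b *: x).

Lemma differentiable_scaled_chain x : differentiable scaled_chain x.
Proof.
apply: differentiableM; first exact: differentiable_cst.
apply: differentiable_comp; last exact: differentiable_chain.
exact: differentiableZ.
Qed.

Lemma grad_scaled_chain x : grad scaled_chain x = (a * b) *: dchain (b *: x).
Proof.
rewrite -grad_chain; apply/rowP => i; rewrite !mxE.
set v := delta_mx 0 i.
pose s (y : 'rV[R]_d) : 'rV[R]_d := b *: y.
have ds : is_diff x s s by apply: is_diffZ.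
have dc : differentiable (@chain R d) (s x) by exact: differentiable_chain.
have -> : scaled_chain = a \*o (@chain R d \o s) by [].
rewrite deriveMl; last by apply: diff_derivable; apply: differentiable_comp.
rewrite deriveE; last exact: differentiable_comp.
rewrite diff_comp//= diff_val linearZ/= -deriveE//.
by rewrite /GRing.scale/= mulrA.
Qed.

Lemma enormZ (c : R) x : 0 <= c -> enorm (c *: x) = c * enorm x.
Proof.
move=> c0; rewrite /enorm.
under eq_bigr => i _ do rewrite mxE exprMn.
by rewrite -mulr_sumr sqrtrM ?sqr_ge0// sqrtr_sqr ger0_norm.
Qed.

Hypotheses (a0 : 0 < a) (b0 : 0 < b).

Lemma scaled_chain_lipschitz x y :
  enorm (grad scaled_chain x - grad scaled_chain y)
    <= a * b ^+ 2 * 123 * enorm (x - y).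
Proof.
have ab0 : 0 <= a * b by rewrite mulr_ge0// ltW.
rewrite !grad_scaled_chain -scalerBr enormZ//.
apply: (le_trans (ler_wpM2l ab0 (dchain_lipschitz _ _))).
rewrite -scalerBr enormZ ?(ltW b0)//.
by rewrite le_eqVlt; apply/orP; left; apply/eqP; ring.
Qed.

Lemma scaled_chain_gap (D : R) : 9 * a * d%:R <= D ->
  ((scaled_chain 0)%:E - ereal_inf (range (fun x => (scaled_chain x)%:E)) <= D%:E)%E.
Proof.
move=> aD; have lb : ((- (9 * a * d%:R))%:E
    <= ereal_inf (range (fun x : 'rV[R]_d => (scaled_chain x)%:E)))%E.
  apply: le_ereal_inf_tmp => _ [x _ <-]; rewrite lee_fin /scaled_chain.
  by have := ler_wpM2l (ltW a0) (chain_lb (b *: x)); lra.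
apply: (@le_trans _ _ (0 - (- (9 * a * d%:R))%:E)%E).
  apply: leeB => //; rewrite lee_fin /scaled_chain scaler0.
  by rewrite mulr_ge0_le0 ?chain0_le0// ltW.
by rewrite sub0e -EFinN opprK lee_fin.
Qed.

Lemma grad_scaled_chain_eq0 x k : (forall j : 'I_d, (k <= j)%N -> x 0 j = 0) ->
  forall i : 'I_d, (k < i)%N -> grad scaled_chain x 0 i = 0.
Proof.
move=> xk i ki; rewrite grad_scaled_chain mxE.
(* Since k < i, the index i has a predecessor, still at least k, so both padded entries vanish. *)
have [i' ei] : exists i' : 'I_d, i = i'.+1 :> nat.
  have id : (i.-1 < d)%N by rewrite (leq_ltn_trans (leq_pred i)).
  by exists (Ordinal id) => /=; rewrite prednK// (leq_ltn_trans _ ki).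
rewrite dchain_eq0 ?mulr0//.
  by rewrite ei padded_ord mxE xk ?mulr0// -ltnS -ei.
by rewrite padded_ord mxE xk ?mulr0// ltnW.
Qed.

Lemma grad_scaled_chain_large x :
  (exists j, x 0 j = 0) -> a * b <= enorm (grad scaled_chain x).
Proof.
move=> [j xj]; have ab0 : 0 <= a * b by rewrite mulr_ge0// ltW.
rewrite grad_scaled_chain enormZ// ler_peMr//.
by apply: (@dchain_large _ _ _ j); rewrite padded_ord mxE xj mulr0; lra.
Qed.

(** Only the smallest frontier index contributes; past it the derivatives are 0, so the sum is a
    single square. *)
Lemma grad_scaled_chain_frontier x :
  \sum_(i < d) (frontier x i)%:R * grad scaled_chain x 0 i ^+ 2
    <= (3 * (a * b)) ^+ 2.
Proof.
have [ex|nex] := pselect (exists k, [exists i : 'I_d, (i == k :> nat) && frontier x i]); last first.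
  rewrite big1 ?sqr_ge0// => i _; case: (boolP (frontier x i)) => [fi|]; last by rewrite mul0r.
  by case: nex; exists i; apply/existsP; exists i; rewrite eqxx.
case: (ex_minnP ex) => _ /existsP[i /andP[/eqP<- fi]] imin {ex}.
have xi (j : 'I_d) : (i <= j)%N -> x 0 j = 0.
  by move: fi => /forallP/(_ j)/implyP h /h/eqP.
rewrite (bigD1 i)//= [X in _ + X]big1 => [|j ji].
  have ab0 : 0 <= a * b by rewrite mulr_ge0// ltW.
  rewrite addr0 fi mul1r -[leLHS]real_normK ?num_real//.
  rewrite ler_pXn2r ?nnegrE//; last exact: mulr_ge0.
  rewrite grad_scaled_chain mxE normrM ger0_norm// mulrC ler_wpM2r// dchain_frontier//.
  by rewrite padded_ord mxE xi// mulr0.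
case: (boolP (frontier x j)) => [fj|]; last by rewrite mul0r.
have ij : (i <= j)%N by apply: imin; apply/existsP; exists j; rewrite eqxx.
rewrite (grad_scaled_chain_eq0 xi) ?expr0n ?mulr0//.
by rewrite ltn_neqAle ij andbT eq_sym.
Qed.

Definition hard_function (Delta L : {posnum R}) (aD : 9 * a * d%:R <= Delta%:num)
    (aL : a * b ^+ 2 * 123 <= L%:num) : fclass d Delta L :=
  FClass differentiable_scaled_chain (scaled_chain_gap aD)
    (fun x y => le_trans (scaled_chain_lipschitz x y)
      (ler_wpM2r (enorm_ge0 (x - y)) aL)).

End HardFunction.

(** The keyed distribution and the Dirac mass at the rescaled chain witness the two suprema; at
    every index t <= T the expected gradient is at least ab/2 > eps. *)
Lemma zr_active_complexity_ge (R : realType) (d : nat)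
    (Delta L sigma2 eps : {posnum R}) (a b : R) (n T : nat) :
  0 < a -> 0 < b -> 9 * a * d%:R <= Delta%:num -> a * b ^+ 2 * 123 <= L%:num ->
  n%:R * (3 * (a * b)) ^+ 2 <= sigma2%:num -> 2 * eps%:num < a * b ->
  (0 < d)%N -> (8 * T <= d * n.+1)%N ->
  ((T.+1%:R)%:E <= zr_active_complexity d Delta L sigma2 eps%:num)%E.
Proof.
move=> a0 b0 aD aL nS eab d0 Td.
pose F := hard_function a0 b0 aD aL.
pose PF : probability (fclass_space d Delta L) R := \d_(F : fclass_space d Delta L).
rewrite /zr_active_complexity.
apply: (le_trans _ (ereal_sup_ubound
  (ex_intro _ (keyed_distribution d Delta L sigma2 n) erefl))).
apply: (le_trans _ (ereal_sup_ubound (ex_intro _ PF erefl))).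
apply: le_ereal_inf_tmp => _ [A zrA ->].
apply: le_ereal_inf_tmp => _ [t tE <-].
(* Index t stands for round t.+1, so the claim reads T <= t. *)
rewrite lee_fin ler_nat ltnS leqNgt; apply/negP => tT.
have tameF x : tame sigma2 n F x.
  rewrite /tame (le_trans _ nS)// ler_wpM2l//.
  exact: grad_scaled_chain_frontier.
have := @expected_grad_ge R d Delta L sigma2 n F
  (@grad_scaled_chain_eq0 R d a b) tameF A zrA (a * b) t.
have ab0 : 0 <= a * b by rewrite mulr_ge0// ltW.
move=> /(_ ab0 (@grad_scaled_chain_large R d a b a0 b0) d0).
have td : (8 * t <= d * n.+1)%N by rewrite (leq_trans _ Td)// leq_mul2l ltnW ?orbT.
move=> /(_ td) /le_trans /(_ tE).
rewrite lee_fin ler_pdivrMr// leNgt [_ * 2]mulrC.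
by rewrite eab.
Qed.

Theorem proposition2 (R : realType) :
  exists c c' C : R, [/\ 0 < c, 0 < c', 0 < C &
    forall Delta L sigma2 eps : {posnum R},
      eps%:num <= c' * Num.sqrt (L%:num * Delta%:num) ->
      exists d : nat, [/\ (0 < d)%N,
        d%:R <= C * (Delta%:num * L%:num / eps%:num ^+ 2) &
        ((c * (Delta%:num * L%:num * sigma2%:num / eps%:num ^+ 4))%:E
          <= zr_active_complexity d Delta L sigma2 eps%:num)%E]].
Proof.
(* Below a * b = 4 eps and a * b ^+ 2 * 123 = L, where 123 is the Lipschitz
   constant of dchain; 9 a d <= Delta then reads d <= Delta L / (144 * 123 eps^2),
   and a frontier derivative is at most 3 a b, with square 144 eps^2. *)
exists (8 * (2 * (144 * 123)) * 144)^-1, (134^-1), 1.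
split; [by rewrite invr_gt0|by rewrite invr_gt0|exact: ltr01|].
move=> Delta L sigma2 eps eps_small.
have [D0 L0 S0 e0] : [/\ 0 < Delta%:num, 0 < L%:num, 0 < sigma2%:num & 0 < eps%:num].
  by [].
set D := Delta%:num in D0 *; set l := L%:num in L0 *; set S := sigma2%:num in S0 *.
set e := eps%:num in e0 eps_small *.
have e20 : 0 < e ^+ 2 by rewrite exprn_gt0.
pose u := D * l / e ^+ 2; pose v := S / e ^+ 2.
have u0 : 0 < u by rewrite divr_gt0// mulr_gt0.
have v0 : 0 < v by rewrite divr_gt0.
(* The choice of c' enters here: 134^2 = 17956 >= 144 * 123 = 17712. This makes d at least 1. *)
have u_ge : 144 * 123 <= u.
  have lD0 : 0 < l * D by rewrite mulr_gt0.
  have : e ^+ 2 <= (134^-1 * Num.sqrt (l * D)) ^+ 2.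
    by rewrite ler_pXn2r// nnegrE ?(ltW e0)// mulr_ge0// sqrtr_ge0.
  by rewrite exprMn sqr_sqrtr ?(ltW lD0)// ler_pdivlMr//; lra.
(* The largest values allowed by the gap Delta and by the variance sigma2. *)
pose d := Num.truncn (u / (144 * 123)); pose n := Num.truncn (v / 144).
have /andP[dle dlt] : d%:R <= u / (144 * 123) < d.+1%:R.
  by apply: truncn_itv; rewrite divr_ge0// ltW.
have /andP[nle nlt] : n%:R <= v / 144 < n.+1%:R.
  by apply: truncn_itv; rewrite divr_ge0// ltW.
have d0 : (0 < d)%N by rewrite truncn_ge_nat; lra.
have d1 : (1 : R) <= d%:R by rewrite ler1n.
(* As d >= 1, truncation loses at most a factor 2. *)
have du : u / (2 * (144 * 123)) <= d%:R by move: dlt; rewrite -natr1; lra.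
exists d; split=> //; first by rewrite mul1r -/u; lra.
pose X := D * l * S / e ^+ 4.
have XE : X = u * v by rewrite /X /u /v; field; rewrite gt_eqF.
have X0 : 0 < X by rewrite XE mulr_gt0.
(* T is the integer part of the claimed bound, which T.+1 therefore exceeds. *)
pose T := Num.truncn ((8 * (2 * (144 * 123)) * 144)^-1 * X).
have /andP[Tle Tlt] : T%:R <= (8 * (2 * (144 * 123)) * 144)^-1 * X < T.+1%:R.
  by apply: truncn_itv; rewrite mulr_ge0 ?(ltW X0)// invr_ge0.
apply: (@le_trans _ _ (T.+1%:R)%:E); first by rewrite lee_fin ltW.
pose a := (16 * 123) * e ^+ 2 / l; pose b := l / ((4 * 123) * e).
have ab : a * b = 4 * e by rewrite /a /b; field; rewrite !gt_eqF.
apply: (@zr_active_complexity_ge _ _ _ _ _ _ a b n) => //.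
- by rewrite divr_gt0// mulr_gt0.
- by rewrite divr_gt0// mulr_gt0.
- have -> : 9 * a * d%:R = (144 * 123) * d%:R * (e ^+ 2 / l) by rewrite /a; field; rewrite gt_eqF.
  rewrite -ler_pdivlMr ?divr_gt0// invf_div.
  have -> : D * (l / e ^+ 2) = u by rewrite /u mulrA.
  by move: dle; lra.
- have -> : a * b ^+ 2 * 123 = l by rewrite /a /b; field; rewrite !gt_eqF.
  by [].
- rewrite ab; have -> : n%:R * (3 * (4 * e)) ^+ 2 = (144 * n%:R) * e ^+ 2 by ring.
  by rewrite -ler_pdivlMr// -/v; lra.
- by rewrite ab -/e; lra.
(* 8 T is at most the product of u / (2 * 144 * 123) <= d and v / 144 < n.+1; the latter inequality
   also covers small variances, where n = 0. *)
- rewrite -(ler_nat R) !natrM.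
  have : u / (2 * (144 * 123)) * (v / 144) <= d%:R * n.+1%:R.
    by apply: ler_pM => //; [by rewrite divr_ge0// ltW|by rewrite divr_ge0// ltW|exact: ltW].
  by move: Tle; rewrite XE; lra.
Qed.
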